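(* Let $\rho : G \to O(V)$ be an orthogonal representation of a compact Lie group $G$ on a real finite-dimensional Euclidean vector space $V$ having property $(\mathcal{B}_k)$. For any $G$-invariant linear subspace $W \subseteq V$ the subrepresentation $\rho' : G \to O(W)$ has property $(\mathcal{B}_k)$ as well.
   Context: For an orthogonal representation $G\to O(V)$ of a compact Lie group, let $\mathbb{R}[V]^G$ be the (finitely generated) algebra of $G$-invariant real polynomials on $V$, $\sigma_1,\ldots,\sigma_n$ homogeneous generators of positive degree, and $\sigma=(\sigma_1,\ldots,\sigma_n):V\to\mathbb{R}^n$ the orbit map; $V/G$ is identified with $\sigma(V)\subseteq\mathbb{R}^n$ via the homeomorphism induced by $\sigma$. A curve in $V/G$ is of class $C^k$ ($k\in\{0,1,2,\ldots,\infty,\omega\}$, $C^\omega$ meaning real analytic) if it is $C^k$ as a curve in $\mathbb{R}^n$ (independent of the choice of generators). A lift of a curve $c$ in $\sigma(V)$ is a curve $\bar c$ in $V$ with $\sigma\circ\bar c=c$; a local lift near $t_0$ is a lift of the restriction of $c$ to an open neighborhood of $t_0$. A differentiable lift has locally bounded derivative if $\|\bar c'\|$ is bounded on compact subsets of its domain. The representation has property $(\mathcal{B}_k)$ if there exists a neighborhood $U$ of $0$ in $V/G=\sigma(V)$ such that each $C^k$-curve in $U$ admits (near each parameter value) a local differentiable lift to $V$ with locally bounded derivative. *)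

(* Defs.v *)
From HB Require Import structures.
From mathcomp Require Import all_boot all_order all_algebra.
From mathcomp Require Import all_classical all_reals all_analysis.
(* The notations of [mpoly] clash with those of the analysis library.  Read
   [mpoly n R] as {mpoly R[n]}, [meval x p] as p.@[x], [comp_mpoly s P] as
   P \mPo s, and [p \is ishomog1 d mdeg] as p \is d.-homog. *)
From mathcomp Require Import -(notations) mpoly.

Set Implicit Arguments.
Unset Strict Implicit.
Unset Printing Implicit Defensive.

Import Order.TTheory GRing.Theory Num.Theory.
Import numFieldNormedType.Exports.

Local Open Scope classical_set_scope.
Local Open Scope ring_scope.

(* In finite dimension, asking for the continuity of the iterated derivatives
   along all vectors is the same as asking it for the partial derivatives.
   [f] is a total function; only its germs at the points of the open set [O]
   matter. *)
Fixpoint Cn_on (R : realType) (U W : normedModType R) (n : nat)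
    (O : set U) (f : U -> W) : Prop :=
  (forall x, O x -> {for x, continuous f}) /\
  (if n is m.+1 then
     (forall x v, O x -> derivable f x v) /\
     (forall v, Cn_on m O (fun x => 'D_v f x))
   else True).

Definition smooth_on (R : realType) (U W : normedModType R)
    (O : set U) (f : U -> W) : Prop := forall n, Cn_on n O f.

#[short(type="topologicalGroupType")]
HB.structure Definition TopologicalGroup := {G of Topological G & Group G}.
(* The structure above only joins a topology and a group law on one carrier;
   their compatibility is [continuous_group_law] below. *)

Definition continuous_group_law (G : topologicalGroupType) : Prop :=
  continuous (fun p : G * G => (p.1 * p.2)%g) /\
  continuous (fun g : G => (g^-1)%g).

(* A chart with domain [chart_dom]; its image in R^d is [chart_cod]. *)
Record chart (R : realType) (G : topologicalType) (d : nat) := Chart {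
  chart_dom : set G;
  chart_map : G -> 'rV[R]_d;
  chart_inv : 'rV[R]_d -> G;
  chart_cod := chart_map @` chart_dom;
  chart_dom_open : open chart_dom;
  chart_cod_open : open chart_cod;
  chart_mapK : forall g, chart_dom g -> chart_inv (chart_map g) = g;
  chart_map_continuous : {within chart_dom, continuous chart_map};
  chart_inv_continuous : {within chart_cod, continuous chart_inv}
}.

Definition smooth_atlas (R : realType) (G : topologicalType) (d : nat)
    (A : set (chart R G d)) : Prop :=
  (forall g, exists2 a, A a & chart_dom a g) /\
  (forall a b, A a -> A b ->
     smooth_on [set x | chart_cod a x /\ chart_dom b (chart_inv a x)]
               (fun x => chart_map b (chart_inv a x))).

(* Multiplication read in the charts [a], [b] (source) and [c] (target), a
   point of R^d x R^d being a row vector of length d + d. *)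
Definition smooth_mul (R : realType) (G : topologicalGroupType) (d : nat)
    (A : set (chart R G d)) : Prop :=
  forall a b c, A a -> A b -> A c ->
    smooth_on
      [set z : 'rV[R]_(d + d) |
         [/\ chart_cod a (lsubmx z), chart_cod b (rsubmx z)
           & chart_dom c (chart_inv a (lsubmx z) * chart_inv b (rsubmx z))%g]]
      (fun z : 'rV[R]_(d + d) =>
         chart_map c (chart_inv a (lsubmx z) * chart_inv b (rsubmx z))%g).

Definition smooth_inv (R : realType) (G : topologicalGroupType) (d : nat)
    (A : set (chart R G d)) : Prop :=
  forall a b, A a -> A b ->
    smooth_on [set x | chart_cod a x /\ chart_dom b ((chart_inv a x)^-1)%g]
              (fun x => chart_map b ((chart_inv a x)^-1)%g).

Definition lie_group (R : realType) (G : topologicalGroupType) : Prop :=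
  [/\ continuous_group_law G, hausdorff_space G, @second_countable G
    & exists d (A : set (chart R G d)),
        [/\ smooth_atlas A, smooth_mul A & smooth_inv A]].

Definition compact_lie_group (R : realType) (G : topologicalGroupType) : Prop :=
  lie_group R G /\ compact [set: G].

(* A Euclidean vector space is a [V : vectType R] (finite-dimensional) with a
   positive definite symmetric bilinear form [ip : {dot V for idfun}]. *)
Section Euclidean.
Context (R : realType) (V : vectType R) (ip : {dot V for idfun}).

Definition enorm (v : V) : R := Num.sqrt (ip v v).

Definition has_derivative (c : R -> V) (t : R) (w : V) : Prop :=
  (fun h : R => enorm (h^-1 *: (c (t + h) - c t) - w)) @ 0^' --> (0 : R).

End Euclidean.

Section SubDot.
Context (R : realType) (V : vectType R) (ip : {dot V for idfun}).
Context (W : {vspace V}).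

Definition sub_dot_fun (u v : subvs_of W) : R := ip (vsval u) (vsval v).

Let sub_dot_linear_l (v : subvs_of W) :
  GRing.linear_for *%R (fun u : subvs_of W => sub_dot_fun u v).
Proof. by move=> a u u'; rewrite /sub_dot_fun linearP linearPl. Qed.

Let sub_dot_linear_r (u : subvs_of W) :
  GRing.linear_for (idfun \; *%R) (sub_dot_fun u).
Proof. by move=> a v v'; rewrite /sub_dot_fun [vsval (_ + _)]linearP linearPr. Qed.

HB.instance Definition _ :=
  @bilinear_isBilinear.Build R (subvs_of W) (subvs_of W) R
    *%R (idfun \; *%R) sub_dot_fun (sub_dot_linear_l, sub_dot_linear_r).

Let sub_dot_sym (u v : subvs_of W) :
  sub_dot_fun u v = (-1) ^+ false * idfun (sub_dot_fun v u).
Proof. exact: hermitian_subproof. Qed.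

HB.instance Definition _ :=
  @isHermitianSesquilinear.Build R (subvs_of W) false idfun sub_dot_fun sub_dot_sym.

Let sub_dot_gt0 (u : subvs_of W) : u != 0 -> 0 < sub_dot_fun u u.
Proof.
move=> u0; apply: neq0_dnorm_gt0; apply: contra u0 => /eqP u0.
by apply/eqP/val_inj; rewrite /= u0.
Qed.

HB.instance Definition _ :=
  @isDotProduct.Build R (subvs_of W) sub_dot_fun sub_dot_gt0.

Definition sub_dot : {dot (subvs_of W) for idfun} := sub_dot_fun.

End SubDot.

Section Representation.
Context (R : realType) (G : topologicalGroupType).

(* As V is finite-dimensional, continuity of all the maps g |-> rho(g) v is
   continuity of rho : G -> O(V); it is then automatically smooth. *)
Record orthogonal_rep (V : vectType R) (ip : {dot V for idfun}) :=
  OrthogonalRep {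
    rep_fun :> G -> 'End(V);
    rep1 : rep_fun 1%g = \1%VF;
    repM : forall g h, rep_fun (g * h)%g = (rep_fun g \o rep_fun h)%VF;
    rep_isometry : forall g u v, ip (rep_fun g u) (rep_fun g v) = ip u v;
    rep_continuous : forall v g0,
      (fun g => enorm ip (rep_fun g v - rep_fun g0 v)) @ g0 --> (0 : R)
  }.

Definition invariant_subspace (V : vectType R) (ip : {dot V for idfun})
    (rho : orthogonal_rep ip) (W : {vspace V}) : Prop :=
  forall g, (rho g @: W <= W)%VS.

Section SubRep.
Context (V : vectType R) (ip : {dot V for idfun}) (rho : orthogonal_rep ip).
Context (W : {vspace V}) (rhoW : invariant_subspace rho W).

(* [vsproj W] is the corestriction to [W]; it is only applied to vectors of
   [W], see [vsval_sub_rep_fun]. *)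
Definition sub_rep_fun (g : G) : 'End(subvs_of W) :=
  linfun (vsproj W \o rho g \o vsval).

Lemma vsval_sub_rep_fun g (w : subvs_of W) :
  vsval (sub_rep_fun g w) = rho g (vsval w).
Proof.
rewrite lfunE /= vsprojK //.
by apply: (subvP (rhoW g)); apply: memv_img; exact: subvsP.
Qed.

Let sub_rep1 : sub_rep_fun 1%g = \1%VF.
Proof.
by apply/lfunP => w; apply/val_inj; rewrite /= vsval_sub_rep_fun rep1 !lfunE.
Qed.

Let sub_repM g h : sub_rep_fun (g * h)%g = (sub_rep_fun g \o sub_rep_fun h)%VF.
Proof.
apply/lfunP => w; apply/val_inj.
by rewrite /= comp_lfunE !vsval_sub_rep_fun repM comp_lfunE.
Qed.

Let sub_rep_isometry g u v :
  sub_dot ip W (sub_rep_fun g u) (sub_rep_fun g v) = sub_dot ip W u v.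
Proof. by rewrite /= /sub_dot_fun !vsval_sub_rep_fun rep_isometry. Qed.

Let sub_rep_continuous v g0 :
  (fun g => enorm (sub_dot ip W) (sub_rep_fun g v - sub_rep_fun g0 v)) @ g0 --> (0 : R).
Proof.
rewrite (_ : (fun g => _) =
  (fun g => enorm ip (rho g (vsval v) - rho g0 (vsval v)))).
  exact: rep_continuous.
apply/funext => g.
by rewrite /enorm /= /sub_dot_fun [vsval (_ - _)]linearB /= !vsval_sub_rep_fun.
Qed.

Definition sub_rep : orthogonal_rep (sub_dot ip W) :=
  OrthogonalRep sub_rep1 sub_repM sub_rep_isometry sub_rep_continuous.

End SubRep.

(* R[V] is the ring of polynomials in the coordinates of the basis
   [vbasis {:V}] of V; it does not depend on the basis. *)
Definition poly_on (V : vectType R) := mpoly (\dim {:V}) R.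

Definition poly_eval (V : vectType R) (p : poly_on V) (v : V) : R :=
  meval (fun i => coord (vbasis {:V}) i v) p.

Definition invariant_poly (V : vectType R) (ip : {dot V for idfun})
    (rho : orthogonal_rep ip) (p : poly_on V) : Prop :=
  forall g v, poly_eval p (rho g v) = poly_eval p v.

Record orbit_generators (V : vectType R) (ip : {dot V for idfun})
    (rho : orthogonal_rep ip) := OrbitGenerators {
  gen_num : nat;
  gen : gen_num.-tuple (poly_on V);
  gen_invariant : forall i, invariant_poly rho (tnth gen i);
  gen_homogeneous : forall i, exists2 d : nat, (0 < d)%N &
    tnth gen i \is ishomog1 d mdeg;
  gen_generate : forall p, invariant_poly rho p ->
    exists P : mpoly gen_num R, p = comp_mpoly gen P
}.

Definition orbit_map (V : vectType R) (ip : {dot V for idfun})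
    (rho : orthogonal_rep ip) (sigma : orbit_generators rho) (v : V) :
    'rV[R]_(gen_num sigma) :=
  \row_i poly_eval (tnth (gen sigma) i) v.

End Representation.

Inductive regularity := Cfinite of nat | Cinfinity | Comega.

Section Curves.
Context (R : realType).

Definition analytic_on (n : nat) (I : set R) (c : R -> 'rV[R]_n) : Prop :=
  forall t, I t -> exists (a : nat -> 'rV[R]_n) (r : R), 0 < r /\
    forall s, `|s - t| < r ->
      series (fun m => (s - t) ^+ m *: a m) @ \oo --> c s.

Definition curve_of_class (k : regularity) (n : nat) (I : set R)
    (c : R -> 'rV[R]_n) : Prop :=
  match k with
  | Cfinite m => Cn_on m I c
  | Cinfinity => smooth_on I c
  | Comega => analytic_on I c
  end.

Context (G : topologicalGroupType) (V : vectType R) (ip : {dot V for idfun}).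
Context (rho : orthogonal_rep G ip) (sigma : orbit_generators rho).

Definition differentiable_local_lift (I : set R)
    (c : R -> 'rV[R]_(gen_num sigma)) (t0 : R) : Prop :=
  exists (J : set R) (cbar dcbar : R -> V),
    [/\ [/\ open J, J t0 & J `<=` I],
        forall t, J t -> orbit_map sigma (cbar t) = c t,
        forall t, J t -> has_derivative ip cbar t (dcbar t)
      & forall K : set R, compact K -> K `<=` J ->
          exists M : R, forall t, K t -> enorm ip (dcbar t) <= M].

(* Property (B_k) of [rho], with V/G realized through the orbit map of [sigma],
   any choice of homogeneous generators of the invariants.
   V/G is then sigma(V) in R^n, on which [within] gives the filter of
   neighborhoods of 0 = sigma(0) for the subspace topology.  Curves are defined
   on arbitrary open intervals [I]. *)
Definition property_B (k : regularity) : Prop :=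
  exists U : set 'rV[R]_(gen_num sigma),
    [/\ U `<=` range (orbit_map sigma),
        within (range (orbit_map sigma)) (nbhs (0 : 'rV[R]_(gen_num sigma))) U
      & forall (I : set R) (c : R -> 'rV[R]_(gen_num sigma)),
          open I -> is_interval I ->
          curve_of_class k I c -> (forall t, I t -> U (c t)) ->
          forall t0, I t0 -> differentiable_local_lift I c t0].

End Curves.

(* Main.v *)
From HB Require Import structures.
Require Import Defs.
From mathcomp Require Import all_boot all_order all_algebra.
From mathcomp Require Import all_classical all_reals all_analysis.
From mathcomp Require Import -(notations) mpoly.

(** Let c be a curve of class C^k near 0 in tau(W).  The restrictions to W of the
    components of sigma are invariant polynomials on W, hence polynomials P_i in
    the components of tau: sigma = P o tau on W ([orbit_map_pullback], applied to
    the inclusion of W).  Thus P o c is a curve in sigma(V); it is again of class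
    C^k ([curve_of_class_poly_map]), and it stays close to 0 because P is
    continuous and P(0) = 0.  The hypothesis on V provides a local lift cbar of
    P o c with locally bounded derivative, and it remains to bring cbar back
    into W.

    This is done by the orthogonal projection pr from V onto W, which is linear,
    commutes with G ([orth_proj_equivariant]) and does not increase norms
    ([enorm_orth_proj]).  The curve pr o cbar therefore inherits differentiability
    and bounds on the derivative ([has_derivative_contraction]).  It lifts c: by
    [orbit_map_pullback] applied to pr, the map tau o pr is a polynomial Q in
    sigma, so if c(t) = tau(w) with w in W then
    tau(pr(cbar(t))) = Q(sigma(cbar(t))) = Q(sigma(w)) = tau(pr(w)) = c(t).

    A polynomial map preserves each class C^k because the scalar functions of
    that class contain the constants and are closed under sums and products
    ([meval_closed]).  For real analytic functions closure under products is
    Mertens' theorem on Cauchy products ([cvg_cauchy_product]). *)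

Set Implicit Arguments.
Unset Strict Implicit.
Unset Printing Implicit Defensive.

Import Order.TTheory GRing.Theory Num.Theory.
Import numFieldNormedType.Exports.

Local Open Scope classical_set_scope.
Local Open Scope ring_scope.

(** * Polynomials as functions *)

Section PolynomialFunctions.
Context (R : realType).

(** Reduces every regularity statement about polynomial maps to constants, sums
    and products, whatever the notion [Q] of regularity. *)
Lemma meval_closed (T : Type) (Q : (T -> R) -> Prop) n (p : mpoly n R)
    (f : T -> 'I_n -> R) :
    (forall a, Q (fun=> a)) ->
    (forall g h, Q g -> Q h -> Q (fun x => g x + h x)) ->
    (forall g h, Q g -> Q h -> Q (fun x => g x * h x)) ->
    (forall i, Q (fun x => f x i)) ->
  Q (fun x => meval (f x) p).
Proof.
move=> Qc QD QM Qf.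
rewrite (_ : (fun x => _) = (fun x => \sum_(m <- msupp p) mcoeff m p *
   \prod_(i < n) f x i ^+ m i)); last by apply/funext => x; rewrite mevalE.
elim: (msupp p) => [|m s IH].
  by rewrite (_ : (fun x => _) = fun=> 0) //; apply/funext => x; rewrite big_nil.
rewrite (_ : (fun x => _) = (fun x => mcoeff m p * \prod_(i < n) f x i ^+ m i +
   \sum_(m <- s) mcoeff m p * \prod_(i < n) f x i ^+ m i)); last first.
  by apply/funext => x; rewrite big_cons.
apply: (QD) => //; apply: (QM) => //.
elim: (index_enum _) => [|i e IHe].
  by rewrite (_ : (fun x => _) = fun=> 1) //; apply/funext => x; rewrite big_nil.
rewrite (_ : (fun x => _) = (fun x => f x i ^+ m i *
   \prod_(i <- e) f x i ^+ m i)); last first.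
  by apply/funext => x; rewrite big_cons.
apply: (QM) => //.
elim: (m i) => [|k IHk].
  by rewrite (_ : (fun x => _) = fun=> 1) //; apply/funext => x; rewrite expr0.
rewrite (_ : (fun x => _) = (fun x => f x i * f x i ^+ k)); first exact: QM.
by apply/funext => x; rewrite exprS.
Qed.

Lemma meval_homogeneous0 n (p : mpoly n R) d :
  (0 < d)%N -> p \is ishomog1 d mdeg -> meval (fun=> 0) p = 0.
Proof.
move=> d0 /dhomogP hp; rewrite mevalE big_seq big1 // => m /hp md.
have {}md : mdeg m = d := md.
suff [i mi] : exists i, m i != 0%N.
  by rewrite (bigD1 i) //= expr0n (negbTE mi) mul0r mulr0.
apply/existsP; apply: contraTT d0; rewrite negb_exists => /forallP m0.
rewrite -md mdegE big1 // => i _; apply/eqP.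
by have := m0 i; rewrite negbK.
Qed.

(** The polynomial on V representing p o f: each coordinate on U is replaced by
    the linear form on V that f pulls it back to. *)
Definition poly_pullback (V U : vectType R) (f : 'Hom(V, U)) (p : poly_on U) :
    poly_on V :=
  comp_mpoly [tuple \sum_(j < \dim {:V})
    coord (vbasis {:U}) i (f (vbasis {:V})`_j) *: mpolyX R (mnm1 j)
    | i < \dim {:U}] p.

Lemma poly_eval_pullback (V U : vectType R) (f : 'Hom(V, U)) (p : poly_on U) v :
  poly_eval (poly_pullback f p) v = poly_eval p (f v).
Proof.
rewrite /poly_eval comp_mpoly_meval; apply: meval_eq => i.
rewrite tnth_mktuple raddf_sum /= [in RHS](coord_vbasis (memvf v)).
rewrite !linear_sum /=; apply: eq_bigr => j _.
by rewrite mevalZ mevalXU !linearZ /= mulrC.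
Qed.

Lemma poly_eval_comp (V : vectType R) n (P : mpoly n R)
    (s : n.-tuple (poly_on V)) v :
  poly_eval (comp_mpoly s P) v = meval (fun i => poly_eval (tnth s i) v) P.
Proof. exact: comp_mpoly_meval. Qed.

End PolynomialFunctions.

(** * Orthogonal projection onto a subspace *)

Section OrthogonalProjection.
Context (R : realType) (V : vectType R) (ip : {dot V for idfun}).
Context (W : {vspace V}).

Lemma ip_eq0 v : ip v v = 0 -> v = 0.
Proof. by move/eqP; apply: contraTeq => v0; rewrite gt_eqF // neq0_dnorm_gt0. Qed.

Lemma ip_ge0 v : 0 <= ip v v.
Proof.
have [->|v0] := eqVneq v 0; first by rewrite linear0l.
exact/ltW/neq0_dnorm_gt0.
Qed.

Lemma enorm_ge0 v : 0 <= enorm ip v.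
Proof. exact: sqrtr_ge0. Qed.

Let b : (\dim W).-tuple (subvs_of W) :=
  [tuple vsproj W (vbasis W)`_i | i < \dim W].

Let valb i : vsval (tnth b i) = (vbasis W)`_i.
Proof.
by rewrite tnth_mktuple vsprojK // vbasis_mem // mem_nth // size_tuple.
Qed.

Let bspan (u : subvs_of W) :
  (forall i, ip (vsval u) (vsval (tnth b i)) = 0) -> u = 0.
Proof.
move=> ub; suff: vsval u = 0 by move=> u0; apply/val_inj.
apply: ip_eq0; rewrite {2}(coord_vbasis (subvsP u)) linear_sum /= big1 // => i _.
by rewrite linearZ /= -valb ub mulr0.
Qed.

(* The frame operator v |-> \sum_i <v, b_i> b_i of a basis (b_i) of W.  It has the
   same value at two vectors exactly when they have the same inner products with
   W, and it is injective on W; composing it with its inverse on W thus gives the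
   orthogonal projection, for any basis. *)
Let frame_fun (v : V) : subvs_of W := \sum_i ip v (vsval (tnth b i)) *: tnth b i.

Let frame_linear : linear frame_fun.
Proof.
move=> a u v; rewrite /frame_fun scaler_sumr -big_split /=.
by apply: eq_bigr => i _; rewrite linearPl scalerDl scalerA.
Qed.

HB.instance Definition _ :=
  GRing.isLinear.Build R V (subvs_of W) *:%R frame_fun frame_linear.

Let frame_inj (v : V) : frame_fun v = 0 -> forall i, ip v (vsval (tnth b i)) = 0.
Proof.
move=> v0 i.
have := congr1 (@vsval _ _ W) v0; rewrite linear_sum linear0 /=.
under eq_bigr do rewrite valb.
move/freeP: (basis_free (vbasisP W)) => + h => /(_ _ h i).
by rewrite valb.
Qed.

Let S : 'End(subvs_of W) := linfun (frame_fun \o vsval).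

Let S_ker : lker S == 0%VS.
Proof.
apply/lker0P => u v /eqP; rewrite -subr_eq0 -linearB /= /S lfunE /=.
move=> /eqP /frame_inj h.
by apply/eqP; rewrite -subr_eq0; apply/eqP/bspan => i; rewrite h.
Qed.

Definition orth_proj : 'Hom(V, subvs_of W) := (S^-1 \o linfun frame_fun)%VF.

Lemma orth_projP (v : V) (w : subvs_of W) :
  ip (vsval (orth_proj v)) (vsval w) = ip v (vsval w).
Proof.
have h i : ip (vsval (orth_proj v) - v) (vsval (tnth b i)) = 0.
  apply: frame_inj; rewrite linearB /=.
  have := lker0_lfunVK S_ker (frame_fun v).
  rewrite lfunE /= /orth_proj comp_lfunE lfunE /= => ->.
  by rewrite subrr.
apply/eqP; rewrite -subr_eq0 -linearBl.
rewrite (coord_vbasis (subvsP w)) linear_sum /= big1 // => i _.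
by rewrite linearZ /= -valb h mulr0.
Qed.

(** [orth_proj v] - u lies in W and is orthogonal to W. *)
Lemma orth_proj_unique (v : V) (u : subvs_of W) :
  (forall w : subvs_of W, ip (vsval u) (vsval w) = ip v (vsval w)) ->
  orth_proj v = u.
Proof.
move=> h; apply/eqP; rewrite -subr_eq0; apply/eqP.
have d (w : subvs_of W) : ip (vsval (orth_proj v) - vsval u) (vsval w) = 0.
  by rewrite linearBl /= orth_projP h subrr.
suff: vsval (orth_proj v - u) = 0 by move=> x0; apply/val_inj.
exact/ip_eq0/(d (orth_proj v - u)).
Qed.

Lemma orth_proj_id (w : subvs_of W) : orth_proj (vsval w) = w.
Proof. exact: orth_proj_unique. Qed.

(** Pythagoras: with u the projection of v, |v|^2 - |u|^2 = |v - u|^2. *)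
Lemma enorm_orth_proj v : enorm (sub_dot ip W) (orth_proj v) <= enorm ip v.
Proof.
rewrite /enorm /= /sub_dot_fun; apply: ler_wsqrtr; rewrite -subr_ge0.
set u := vsval _; have uv : ip u (v - u) = 0.
  by rewrite linearB /= (hermC ip u v) mul1r /= orth_projP subrr.
have vu : ip v u = ip u u by rewrite orth_projP.
suff -> : ip v v - ip u u = ip (v - u) (v - u) by exact: ip_ge0.
by rewrite linearBl /= uv subr0 linearB /= vu.
Qed.

End OrthogonalProjection.

Lemma has_derivative_contraction (R : realType) (V U : vectType R)
    (ipV : {dot V for idfun}) (ipU : {dot U for idfun}) (f : 'Hom(V, U))
    (c : R -> V) t w :
  (forall v, enorm ipU (f v) <= enorm ipV v) ->
  has_derivative ipV c t w -> has_derivative ipU (f \o c) t (f w).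
Proof.
move=> fle; rewrite /has_derivative => cw.
apply: squeeze_cvgr (cvg_cst _) cw; near=> h.
by rewrite enorm_ge0 /= -!linearB -linearZ -linearB fle.
Unshelve. all: by end_near. Qed.

Section Equivariance.
Context (R : realType) (G : topologicalGroupType).
Context (V : vectType R) (ip : {dot V for idfun}) (rho : orthogonal_rep G ip).
Context (W : {vspace V}) (rhoW : invariant_subspace rho W).

(** G acts by isometries and maps W onto itself, so rho(g) applied to the
    projection of v has the inner products with W that characterize the
    projection of rho(g) v. *)
Lemma orth_proj_equivariant g v :
  orth_proj ip W (rho g v) = sub_rep rhoW g (orth_proj ip W v).
Proof.
apply: orth_proj_unique => w.
have [w' ->] : exists w', w = sub_rep rhoW g w'.
  exists (sub_rep rhoW g^-1%g w).
  by rewrite -comp_lfunE -repM mulgV rep1 lfunE.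
rewrite !(vsval_sub_rep_fun rhoW).
apply: etrans (rep_isometry rho _ _ _) _.
by rewrite orth_projP (rep_isometry rho).
Qed.

End Equivariance.

(** * Curves of class C^n *)

Section RowConvergence.
Context (R : realType) (n : nat).

Lemma cvg_rowP (T : Type) (F : set_system T) (FF : Filter F)
    (f : T -> 'rV[R]_n) (M : 'rV[R]_n) :
  f @ F --> M <-> forall j, (fun x => f x 0 j) @ F --> M 0 j.
Proof.
split=> [fM j|fM].
  exact: (cvg_comp _ _ fM (@coord_continuous _ _ _ 0 j M)).
apply/cvgrPdist_le => e e0; near=> x.
rewrite /Num.Def.normr /= mx_normrE (bigmax_le _ (ltW e0))//= => -[i j] _ /=.
rewrite !mxE ord1; move: j; near: x; apply: filter_forall => /= j.
exact: (cvgrPdist_le _ _).1 (fM j) e e0.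
Unshelve. all: by end_near. Qed.

End RowConvergence.

Section CnCurves.
Context (R : realType).

Lemma Cn_on_continuous (U W : normedModType R) n (O : set U) (f : U -> W) x :
  Cn_on n O f -> O x -> {for x, continuous f}.
Proof. by case: n => [|n] [h _]; exact: h. Qed.

Lemma near_eq_continuous_at (U W : normedModType R) (f g : U -> W) x :
  (\near x, f x = g x) -> {for x, continuous f} -> {for x, continuous g}.
Proof.
move=> fg cf; change (g @ x --> g x); rewrite -(nbhs_singleton fg).
exact: (cvg_trans (near_eq_cvg fg) cf).
Qed.

(** On an open set the derivatives only depend on the values there.  This makes it
    possible to replace the derivative of a sum, of a product or of a vector
    function by the expected expression, which agrees with it on [O] only. *)
Lemma eq_Cn_on (U W : normedModType R) n (O : set U) (f g : U -> W) :
  open O -> (forall x, O x -> f x = g x) -> Cn_on n O f -> Cn_on n O g.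
Proof.
move=> Oo; elim: n f g => [|n IH] f g fg [cf df].
all: have nfg x : O x -> \near x, f x = g x
  by move=> Ox; apply: filterS fg _; exact: open_nbhs_nbhs.
all: split=> [x Ox|].
- exact: (near_eq_continuous_at (nfg x Ox) (cf x Ox)).
- by [].
- exact: (near_eq_continuous_at (nfg x Ox) (cf x Ox)).
- case: df => df1 df2; split=> [x v Ox|v].
    exact: near_eq_derivable (nfg x Ox) (df1 x v Ox).
  by apply: IH (df2 v) => x Ox; exact: near_eq_derive (nfg x Ox).
Qed.

Lemma Cn_onW (U W : normedModType R) n (O : set U) (f : U -> W) :
  Cn_on n.+1 O f -> Cn_on n O f.
Proof.
elim: n f => [|n IH] f [cf [df ddf]]; first by split.
by split => //; split => // v; apply: IH.
Qed.

Lemma Cn_on_cst (U W : normedModType R) n (O : set U) (a : W) :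
  open O -> Cn_on n O (fun=> a).
Proof.
move=> Oo; elim: n a => [|n IH] a; split => //; try by move=> x Ox; exact: cvg_cst.
split=> [x v Ox|v]; first exact: derivable_cst.
by apply: eq_Cn_on (IH 0) => // x Ox; rewrite derive_cst.
Qed.

Lemma Cn_onD (U W : normedModType R) n (O : set U) (f g : U -> W) :
  open O -> Cn_on n O f -> Cn_on n O g -> Cn_on n O (fun x => f x + g x).
Proof.
move=> Oo; elim: n f g => [|n IH] f g [cf df] [cg dg]; split => //.
1,2: by move=> x Ox; apply: cvgD; [exact: cf|exact: cg].
case: df => df ddf; case: dg => dg ddg.
split=> [x v Ox|v]; first by apply: derivableD; [exact: df|exact: dg].
apply: eq_Cn_on (IH _ _ (ddf v) (ddg v)) => // x Ox.
by rewrite deriveD //; [exact: df|exact: dg].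
Qed.

Lemma Cn_onM (U : normedModType R) n (O : set U) (f g : U -> R) :
  open O -> Cn_on n O f -> Cn_on n O g -> Cn_on n O (fun x => f x * g x).
Proof.
move=> Oo; elim: n f g => [|n IH] f g Cf Cg.
all: have [cf df] := Cf; have [cg dg] := Cg; split => //.
1,2: by move=> x Ox; apply: cvgM; [exact: cf|exact: cg].
case: df => df ddf; case: dg => dg ddg.
split=> [x v Ox|v]; first by apply: derivableM; [exact: df|exact: dg].
(* In the derivative f * g' + g * f' all factors are of class C^n, so that the
   induction hypothesis applies to both products. *)
have h := Cn_onD Oo (IH _ _ (Cn_onW Cf) (ddg v)) (IH _ _ (Cn_onW Cg) (ddf v)).
apply: eq_Cn_on h => // x Ox.
by rewrite deriveM //; [exact: df|exact: dg].
Qed.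

Lemma Cn_on_rowP (U : normedModType R) n m (O : set U) (f : U -> 'rV[R]_m) :
  open O ->
  Cn_on n O f <-> forall j, Cn_on n O (fun x => f x 0 j).
Proof.
move=> Oo; elim: n f => [|n IH] f; split.
- move=> [cf _] j; split => // x Ox.
  by have /cvg_rowP := cf x Ox; exact.
- move=> h; split => // x Ox; apply/cvg_rowP => j; exact: (h j).1.
- move=> [cf [df ddf]] j; split => [x Ox|].
    by have /cvg_rowP := cf x Ox; exact.
  split=> [x v Ox|v]; first by have /derivable_mxP := df x v Ox; exact.
  have /IH/(_ j) := ddf v; apply: eq_Cn_on => // x Ox.
  by rewrite derive_mx ?mxE //; exact: df.
- move=> h; have df x v : O x -> derivable f x v.
    move=> Ox; apply/derivable_mxP => i j; rewrite ord1; exact: (h j).2.1.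
  split=> [x Ox|]; first by apply/cvg_rowP => j; exact: (h j).1.
  split=> // v; apply/IH => j; apply: eq_Cn_on ((h j).2.2 v) => // x Ox.
  by rewrite derive_mx ?mxE //; exact: df.
Qed.

End CnCurves.

(** * Real analytic functions *)

Section CauchyProduct.
Context (R : realType).

Definition cauchy_product (u v : R^nat) : R^nat :=
  fun n => \sum_(i < n.+1) u i * v (n - i)%N.

Lemma series_cauchy_product (u v : R^nat) n :
  series (cauchy_product u v) n = \sum_(i < n) u i * series v (n - i)%N.
Proof.
elim: n => [|n IH]; first by rewrite /series /= big_geq // big_ord0.
rewrite seriesSr IH [RHS](eq_bigr (fun i : 'I_n.+1 =>
  u i * series v (n - i)%N + u i * v (n - i)%N)); last first.
  by move=> i _; rewrite (subSn (ltn_ord i : (i <= n)%N)) seriesSr mulrDr.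
rewrite big_split /= big_ord_recr /= subnn.
by rewrite [series v 0%N]/series /= big_geq // mulr0 addr0.
Qed.

Lemma series_norm_mono (u : R^nat) m n : (m <= n)%N ->
  series (fun i => `|u i|) m <= series (fun i => `|u i|) n.
Proof.
by move=> mn; rewrite -subr_ge0 sub_series_geq // sumr_ge0.
Qed.

Definition abs_series (u : R^nat) := series (fun i => `|u i|).

(** The difference is \sum_(i < n) u_i (V_n - V_(n-i)), with V the partial sums of
    v.  The terms with i < n/2 involve only v_j with j >= n/2, the others only u_i
    with i >= n/2; in both cases a tail of a convergent series appears. *)
Lemma cauchy_product_error (u v : R^nat) n :
  `|series u n * series v n - series (cauchy_product u v) n| <=
  abs_series u n * (abs_series v n - abs_series v n./2) +
  (abs_series u n - abs_series u n./2) * abs_series v n.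
Proof.
rewrite /abs_series.
set Un := series (fun i => `|u i|); set Vn := series (fun i => `|v i|).
have sumE w : series w n = \sum_(i < n) w i by rewrite /series /= big_mkord.
rewrite series_cauchy_product [series u n]sumE mulr_suml -sumrB.
apply: le_trans (ler_norm_sum _ _ _) _.
have hn : (n./2 <= n)%N by rewrite leq_half_double -addnn leqW // leq_addr.
have -> : Un n - Un n./2 = \sum_(i < n) (n./2 <= i)%:R * `|u i|.
  rewrite sub_series_geq // (big_nat_widenl _ 0%N) // big_mkord.
  rewrite [RHS](bigID (fun i : 'I_n => n./2 <= i)%N) /= [X in _ + X]big1 ?addr0.
    by apply: eq_bigr => i ->; rewrite mul1r.
  by move=> i /negbTE ->; rewrite mul0r.
rewrite [Un n]sumE !mulr_suml -big_split /=.
apply: ler_sum => i _.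
have le1 : `|series v n - series v (n - i)%N| <= Vn n - Vn (n - i)%N.
  by rewrite !sub_series_geq ?leq_subr //; exact: ler_norm_sum.
rewrite -mulrBr normrM; apply: le_trans (ler_wpM2l _ le1) _ => //.
have [hi|hi] := leqP n./2 i.
  rewrite mul1r -mulrDr ler_wpM2l // -[leLHS]add0r lerD //.
    by rewrite subr_ge0 series_norm_mono.
  by rewrite lerBlDr lerDl sumr_ge0.
rewrite !mul0r addr0 ler_wpM2l // lerB // series_norm_mono //.
rewrite leq_subRL ?(ltnW (ltn_ord i)) //.
rewrite -[leqRHS]odd_double_half -addnn addnA leq_add2r;
  exact: leq_trans (ltnW hi) (leq_addl _ _).
Qed.

Lemma cvg_half : (fun n => n./2) @ \oo --> \oo.
Proof.
by apply/cvgnyPge => A; exists A.*2 => // n /= An; rewrite -(doubleK A) half_leq.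
Qed.

(** Mertens' theorem, for two absolutely convergent series. *)
Lemma cvg_cauchy_product (u v : R^nat) (a b : R) :
  cvgn (abs_series u) -> cvgn (abs_series v) ->
  series u @ \oo --> a -> series v @ \oo --> b ->
  series (cauchy_product u v) @ \oo --> a * b.
Proof.
set Un := abs_series u; set Vn := abs_series v => cU cV ua vb.
have h : (fun n => Un n * (Vn n - Vn n./2) + (Un n - Un n./2) * Vn n)
    @ \oo --> (0 : R).
  rewrite -[X in _ --> X](_ : limn Un * (limn Vn - limn Vn) +
                              (limn Un - limn Un) * limn Vn = 0).
    apply: cvgD; apply: cvgM => //; apply: cvgB => //;
      apply: (cvg_comp _ _ cvg_half).
      exact: cV.
    exact: cU.
  by rewrite !subrr mulr0 mul0r addr0.
rewrite (_ : series _ = fun n => series u n * series v n -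
    (series u n * series v n - series (cauchy_product u v) n)).
  rewrite -[X in _ --> X]subr0; apply: cvgB; first exact: cvgM.
  apply/norm_cvg0P; apply: squeeze_cvgr (cvg_cst _) h.
  by near=> n; rewrite normr_ge0 /=; exact: cauchy_product_error.
by apply/funext => n; rewrite subKr.
Unshelve. all: by end_near. Qed.

Definition analytic_at (f : R -> R) (t : R) : Prop :=
  exists (a : R^nat) (r : R), 0 < r /\
    forall s, `|s - t| < r -> pseries a (s - t) @ \oo --> f s.

Lemma analytic_at_cst (a t : R) : analytic_at (fun=> a) t.
Proof.
exists (fun i => (i == 0%N)%:R * a), 1; split => // s _.
apply: cvg_near_cst; near=> n.
have n0 : (0 < n)%N by near: n; exists 1%N.
rewrite /pseries /series /= big_ltn // expr0 mulr1 mul1r big_nat big1 ?addr0 //.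
by move=> i /andP[i0 _]; rewrite gtn_eqF // !mul0r.
Unshelve. all: by end_near. Qed.

Lemma analytic_atD (f g : R -> R) t :
  analytic_at f t -> analytic_at g t -> analytic_at (fun s => f s + g s) t.
Proof.
move=> [a [r [r0 fa]]] [b [r' [r'0 gb]]].
exists (fun i => a i + b i), (Num.min r r'); split; first by rewrite lt_min r0.
move=> s; rewrite lt_min => /andP[sr sr'].
rewrite (_ : pseries _ _ = pseries a (s - t) + pseries b (s - t)).
  by apply: cvgD; [exact: fa|exact: gb].
rewrite /pseries -seriesD; congr series; apply/funext => i /=.
by rewrite mulrDl.
Qed.

(** A power series converges absolutely inside its interval of convergence: it
    converges at t + x, for x halfway between |s - t| and r. *)
Lemma pseries_norm_cvg (a : R^nat) (f : R -> R) t r s :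
  0 < r -> (forall s, `|s - t| < r -> pseries a (s - t) @ \oo --> f s) ->
  `|s - t| < r -> cvgn (abs_series (fun i => a i * (s - t) ^+ i)).
Proof.
move=> r0 fa sr; pose x := (`|s - t| + r) / 2.
have x0 : 0 < x by rewrite divr_gt0 // ltr_wpDl.
have xr : x < r by rewrite ltr_pdivrMr // mulr_natr mulr2n ltrD2r.
have sx : `|s - t| < x by rewrite ltr_pdivlMr // mulr_natr mulr2n ltrD2l.
have Cx : cvgn (pseries a x).
  apply/cvg_ex; exists (f (t + x)); have := fa (t + x).
  by rewrite addrAC subrr add0r gtr0_norm //; exact.
have := is_cvg_pseries_inside_norm Cx (_ : `| `|s - t| | < `|x|).
rewrite normr_id (gtr0_norm x0) => /(_ sx).
rewrite /abs_series /pseries (_ : (fun i => `|_ * _|) =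
    (fun i => `|a i| * `|s - t| ^+ i)) //.
by apply/funext => i; rewrite normrM normrX.
Qed.

Lemma analytic_atM (f g : R -> R) t :
  analytic_at f t -> analytic_at g t -> analytic_at (fun s => f s * g s) t.
Proof.
move=> [a [r [r0 fa]]] [b [r' [r'0 gb]]].
exists (cauchy_product a b), (Num.min r r'); split; first by rewrite lt_min r0.
move=> s; rewrite lt_min => /andP[sr sr'].
rewrite (_ : pseries _ _ = series (cauchy_product
    (fun i => a i * (s - t) ^+ i) (fun i => b i * (s - t) ^+ i))).
  apply: cvg_cauchy_product; [| |exact: fa|exact: gb].
    exact: pseries_norm_cvg fa sr.
  exact: pseries_norm_cvg gb sr'.
rewrite /pseries; congr series; apply/funext => i /=.
rewrite /cauchy_product mulr_suml; apply: eq_bigr => j _.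
by rewrite mulrACA -exprD subnKC // -ltnS.
Qed.

Lemma analytic_on_rowP n (I : set R) (c : R -> 'rV[R]_n) :
  analytic_on I c <-> forall t j, I t -> analytic_at (fun s => c s 0 j) t.
Proof.
have E (a : nat -> 'rV[R]_n) x j :
    (fun m => series (fun m => x ^+ m *: a m) m 0 j) =
      pseries (fun m => a m 0 j) x.
  apply/funext => m; rewrite /pseries /series /= summxE.
  by apply: eq_bigr => i _; rewrite mxE mulrC.
split.
  move=> h t j /h[a [r [r0 ha]]]; exists (fun m => a m 0 j), r.
  split => // s /ha /cvg_rowP /(_ j).
  by rewrite E.
move=> h t It; have /choice[a ha] := fun j => h t j It.
have /choice[r hr] := ha.
(* Starting the minimum at 1 keeps it positive when n = 0. *)
exists (fun m => \row_j a j m), (\big[Num.min/1]_j r j); split.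
  by apply: lt_bigmin => // j _; exact: (hr j).1.
move=> s sr; apply/cvg_rowP => j; rewrite E.
rewrite (_ : (fun m => _) = a j); last by apply/funext => m; rewrite mxE.
apply: (hr j).2; apply: lt_le_trans sr _; exact: bigmin_le.
Qed.

End CauchyProduct.

(** * Polynomial maps *)

Section PolynomialMaps.
Context (R : realType) (m n : nat).
Implicit Types (P : 'I_n -> mpoly m R).

Definition poly_map P (x : 'rV[R]_m) : 'rV[R]_n :=
  \row_i meval (fun j => x 0 j) (P i).

Let poly_mapE T P i (f : T -> 'rV[R]_m) :
  (fun x => (poly_map P \o f) x 0 i) =
  (fun x => meval (fun j => f x 0 j) (P i)).
Proof. by apply/funext => x; rewrite /= mxE. Qed.

Lemma Cn_on_poly_map (U : normedModType R) P d (O : set U) (f : U -> 'rV[R]_m) :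
  open O -> Cn_on d O f -> Cn_on d O (poly_map P \o f).
Proof.
move=> Oo /(Cn_on_rowP _ _ Oo) Cf; apply/(Cn_on_rowP _ _ Oo) => i.
rewrite poly_mapE; apply: (@meval_closed R _ (Cn_on d O)) => //.
- by move=> a; exact: Cn_on_cst.
- by move=> g h; exact: Cn_onD.
- by move=> g h; exact: Cn_onM.
Qed.

Lemma poly_map_continuous P x : {for x, continuous (poly_map P)}.
Proof.
have id0 : Cn_on 0 setT (@id 'rV[R]_m).
  by split => // y _; exact: cvg_id.
exact: (Cn_on_continuous (x := x) (Cn_on_poly_map P openT id0) Logic.I).
Qed.

Lemma analytic_on_poly_map P (I : set R) (c : R -> 'rV[R]_m) :
  analytic_on I c -> analytic_on I (poly_map P \o c).
Proof.
move=> /analytic_on_rowP Cc; apply/analytic_on_rowP => t i It.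
rewrite poly_mapE; apply: (@meval_closed R _ (fun g => analytic_at g t)).
- by move=> a; exact: analytic_at_cst.
- by move=> g h; exact: analytic_atD.
- by move=> g h; exact: analytic_atM.
- by move=> j; exact: Cc.
Qed.

Lemma curve_of_class_poly_map P k (I : set R) (c : R -> 'rV[R]_m) :
  open I -> curve_of_class k I c -> curve_of_class k I (poly_map P \o c).
Proof.
move=> Io; case: k => [d|Cc d|]; first exact: Cn_on_poly_map.
  exact/Cn_on_poly_map/Cc.
exact: analytic_on_poly_map.
Qed.

End PolynomialMaps.

(** * Orbit maps *)

Section OrbitMaps.
Context (R : realType) (G : topologicalGroupType).

Lemma orbit_map0 (V : vectType R) (ip : {dot V for idfun})
    (rho : orthogonal_rep G ip) (sigma : orbit_generators rho) :
  orbit_map sigma 0 = 0.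
Proof.
apply/rowP => i; rewrite !mxE; have [d d0 hd] := gen_homogeneous i.
rewrite /poly_eval (meval_eq (v2 := fun=> 0)); last by move=> j; rewrite linear0.
exact: meval_homogeneous0 hd.
Qed.

(** An equivariant linear map pulls invariant polynomials back to invariant
    polynomials, which are polynomials in the generators [sigma]. *)
Lemma orbit_map_pullback (V U : vectType R) (ipV : {dot V for idfun})
    (ipU : {dot U for idfun}) (rho : orthogonal_rep G ipV)
    (rho' : orthogonal_rep G ipU) (sigma : orbit_generators rho)
    (tau : orbit_generators rho') (f : 'Hom(V, U)) :
  (forall g v, f (rho g v) = rho' g (f v)) ->
  exists P : 'I_(gen_num tau) -> mpoly (gen_num sigma) R,
    forall v, orbit_map tau (f v) = poly_map P (orbit_map sigma v).
Proof.
move=> fE.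
have /choice[P hP] : forall i, exists P,
    poly_pullback f (tnth (gen tau) i) = comp_mpoly (gen sigma) P.
  move=> i; apply: gen_generate => g v.
  by rewrite !poly_eval_pullback fE; exact: gen_invariant.
exists P => v; apply/rowP => i; rewrite !mxE -poly_eval_pullback hP poly_eval_comp.
by apply: meval_eq => j; rewrite mxE.
Qed.

End OrbitMaps.

Theorem proposition7p1 (R : realType) (G : topologicalGroupType)
    (hG : compact_lie_group R G)
    (V : vectType R) (ip : {dot V for idfun}%R) (rho : orthogonal_rep G ip)
    (W : {vspace V}) (rhoW : invariant_subspace rho W) (k : regularity)
    (sigma : orbit_generators rho) (tau : orbit_generators (sub_rep rhoW)) :
  property_B sigma k -> property_B tau k.
Proof.
move=> [U [Urange Unbhs Ulift]].
have inclE g (w : subvs_of W) :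
    linfun vsval (sub_rep rhoW g w) = rho g (linfun (@vsval _ _ W) w).
  rewrite [LHS]lfunE [X in rho g X]lfunE; exact: (vsval_sub_rep_fun rhoW).
(* sigma = P o tau on W, and tau o pr = Q o sigma on V. *)
have [P hP] := orbit_map_pullback tau sigma inclE.
have [Q hQ] := orbit_map_pullback sigma tau (orth_proj_equivariant rhoW).
exists [set x | range (orbit_map tau) x /\ U (poly_map P x)]; split.
- by move=> x [].
- (* P maps tau(W) into sigma(V), so preimages under P of relative
     neighborhoods of 0 are relative neighborhoods of 0. *)
  have P0 : poly_map P 0 = 0.
    by rewrite -[X in poly_map P X](orbit_map0 tau) -hP linear0 orbit_map0.
  have cP : poly_map P @ (0 : 'rV[R]_(gen_num tau)) -->
      (0 : 'rV[R]_(gen_num sigma)).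
    by rewrite -[X in _ --> X]P0; exact: poly_map_continuous.
  apply: (@filterS _ (nbhs (0 : 'rV[R]_(gen_num tau))) _ (poly_map P @^-1`
    [set y | range (orbit_map sigma) y -> U y]) _ _ (cP _ Unbhs)) => x /= Ux xr.
  split => //; apply: Ux.
  by case: xr => w _ <-; rewrite -hP; exists (linfun vsval w).
move=> I c Io Iitv Cc cU t0 It0.
have [||J [cbar [dcbar [[Jo Jt0 JI] lift dlift dbound]]]] :=
  Ulift I (poly_map P \o c) Io Iitv _ _ t0 It0.
- exact: curve_of_class_poly_map.
- by move=> t /cU[].
exists J, (orth_proj ip W \o cbar), (orth_proj ip W \o dcbar); split => //.
- move=> t Jt; have [[w _ wt] _] := cU t (JI t Jt).
  rewrite /= hQ lift //= -wt -hP -hQ [X in orth_proj _ _ X]lfunE.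
  by rewrite orth_proj_id.
- move=> t Jt; apply: has_derivative_contraction (dlift t Jt).
  exact: enorm_orth_proj.
- move=> K Kc KJ; have [M hM] := dbound K Kc KJ; exists M => t Kt.
  exact: le_trans (enorm_orth_proj _ _ _) (hM t Kt).
Qed.
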